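(* Consider the geometric model of the Lorenz equations described in the context, started at $u$ and observed at time points $t_i=ih$, $i=0,1,\ldots$, with observation matrix $H$, and suppose that the observation errors are uniformly distributed on $[-\epsilon,\epsilon]^{d_o}$. Suppose that the prior $q$ satisfies $q(v)>0$ for every $v\in\Lambda^{\mathrm{geo}}$. Then for Lebesgue almost every initial point $u\in\Lambda^{\mathrm{geo}}$, for $\epsilon\cdot h$ sufficiently small, the smoothing distribution given the observations up to time $t_k$, for any $k\in\mathbb N$, satisfies that the expected diameter of its support is at least $$\frac{c_{\mathrm{sm}}\,h\,\epsilon}{\|H\|_\infty}$$ for some constant $c_{\mathrm{sm}}>0$ only depending on the parameters of the model.
   Context: Geometric model. Parameters: $0<\lambda_3<\lambda_1<\lambda_2$ and $\theta$; put $\alpha=\lambda_3/\lambda_1$, $\beta=\lambda_2/\lambda_1$ and assume $\frac1{\sqrt2}<\alpha<1$, $\beta>\frac{\log 6}{\log 2}-1$, $\frac{2^\alpha}{\sqrt2\,\alpha}<\theta<2^\alpha$. Let $S=\{(u_1,u_2,1):|u_1|\le\frac12,|u_2|\le\frac12\}$, $S^*=\{u\in S:u_1\ne0\}$, $\Gamma=\{u\in S:u_1=0\}$. Linear phase: a path started at $u\in S$ follows $\Psi^{\mathrm{lin}}_t(u)=(u_1e^{\lambda_1t},u_2e^{-\lambda_2t},u_3e^{-\lambda_3t})$ until it reaches $\Sigma=\{|u_1|=1\}$. For $u\in S^*$ this happens at time $\tau_\Sigma(u)=\frac1{\lambda_1}\log(1/|u_1|)$ at the point $(\mathrm{sgn}(u_1),u_2|u_1|^\beta,|u_1|^\alpha)$;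 paths started on $\Gamma$ follow the linear flow forever and converge to the origin. Rotation phase: from the point $w=(\pm1,w_2,w_3)$ reached on $\Sigma$, with $r(s)=1-w_3+\left(\frac12-(\theta-1)w_3\right)\frac{s}{(3/2)\pi}$, the path for $0\le s\le\frac32\pi$ is $\Psi^{\mathrm{rot}}_s(w)=\left(1+r(s)\sin s,\ w_2-\frac14\frac{s}{(3/2)\pi},\ 1-r(s)\cos s\right)$ if $w_1=1$, and $\Psi^{\mathrm{rot}}_s(w)=\left(-1-r(s)\sin s,\ w_2+\frac14\frac{s}{(3/2)\pi},\ 1-r(s)\cos s\right)$ if $w_1=-1$. At $s=\frac32\pi$ the path is back in $S$ and the linear phase starts again. $\Lambda^{\mathrm{geo}}\subset\mathbb R^3$ is the union of all points on paths started in $S$ until their first return to $S$ (including the points on the non-returning paths started on $\Gamma$). $\Psi^{\mathrm{geo}}_t$ is the semigroup on $\Lambda^{\mathrm{geo}}$ obtained by concatenating the two phases, and $u(t):=\Psi^{\mathrm{geo}}_t(u)$. Observations: $Y_i=Hu(t_i)+Z_i$ with $H\in\mathbb R^{d_o\times3}$, $Z_i$ i.i.d. uniform on $[-\epsilon,\epsilon]^{d_o}$, $\epsilon>0$, $h>0$. The prior $q$ is a probability density on $\Lambda^{\mathrm{geo}}$. The smoothing distribution given $Y_0,\ldots,Y_k$ has density at $v\in\Lambda^{\mathrm{geo}}$ proportional to $q(v)\prod_{i=0}^k\eta(Y_i-Hv(t_i))$, with $\eta$ the noise density; its support is the set of points where this density is nonzero. The expectation is over the noise, for the fixed true initial point $u$.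 $\|H\|_\infty$ is the operator norm induced by $\|\cdot\|_\infty$.
   Formalization: The constant c_sm may depend on d_o and on an arbitrary upper bound for the step size h, besides λ_1, λ_2, λ_3, θ; with c_sm independent of h (or of d_o) the claim fails, e.g. for H the identity and h large, where the diameter is at most 2ε. *)

(* Defs.v *)
From HB Require Import structures.
From mathcomp Require Import all_boot all_order all_algebra.
From mathcomp Require Import all_classical all_reals all_analysis.
Import Order.TTheory GRing.Theory Num.Theory.
Import numFieldNormedType.Exports.

Set Implicit Arguments.
Unset Strict Implicit.
Unset Printing Implicit Defensive.

Local Open Scope classical_set_scope.
Local Open Scope ring_scope.

Record lorenz_param (R : realType) := LorenzParam {
  lam1 : R; lam2 : R; lam3 : R; theta : R }.

(* The point (u_1, u_2, u_3) is ((u_1, u_2), u_3); the norm that the library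
   puts on this type is the sup norm. *)
Notation R3 R := (R * R * R)%type.

Section GeometricModel.
Context {R : realType}.

Definition lebesgue3 : set (R3 R) -> \bar R :=
  ((@lebesgue_measure R \x @lebesgue_measure R) \x @lebesgue_measure R)%E.

Variable m : lorenz_param R.

Definition alpha : R := lam3 m / lam1 m.
Definition beta : R := lam2 m / lam1 m.

Definition admissible : Prop :=
  [/\ 0 < lam3 m, lam3 m < lam1 m & lam1 m < lam2 m] /\
  [/\ (Num.sqrt 2)^-1 < alpha, alpha < 1,
      ln 6 / ln 2 - 1 < beta,
      2 `^ alpha / (Num.sqrt 2 * alpha) < theta m & theta m < 2 `^ alpha].

Definition section_S : set (R3 R) :=
  [set u | [/\ `|u.1.1| <= 2^-1, `|u.1.2| <= 2^-1 & u.2 = 1]].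

Definition lin_flow (t : R) (u : R3 R) : R3 R :=
  (u.1.1 * expR (lam1 m * t), u.1.2 * expR (- (lam2 m * t)),
   u.2 * expR (- (lam3 m * t))).

(* tau_sigma and hit_sigma are meant for points of S off Gamma. *)
Definition tau_sigma (u : R3 R) : R := (lam1 m)^-1 * ln (`|u.1.1|^-1).

Definition hit_sigma (u : R3 R) : R3 R :=
  (Num.sg u.1.1, u.1.2 * `|u.1.1| `^ beta, `|u.1.1| `^ alpha).

Definition rot_time : R := 3 / 2 * pi.

Definition rot_radius (s w3 : R) : R :=
  1 - w3 + (2^-1 - (theta m - 1) * w3) * (s / rot_time).

(* Applied only to points w of Sigma, i.e. with w_1 = 1 or w_1 = -1. *)
Definition rot_flow (s : R) (w : R3 R) : R3 R :=
  let r := rot_radius s w.2 in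
  if w.1.1 == 1 then
    (1 + r * sin s, w.1.2 - 4^-1 * (s / rot_time), 1 - r * cos s)
  else
    (- 1 - r * sin s, w.1.2 + 4^-1 * (s / rot_time), 1 - r * cos s).

Definition return_time (u : R3 R) : R := tau_sigma u + rot_time.

Definition return_map (u : R3 R) : R3 R := rot_flow rot_time (hit_sigma u).

(* The path started at u in S, up to its first return to S; it stays in the
   linear phase forever when u_1 = 0. *)
Definition loop_path (u : R3 R) (t : R) : R3 R :=
  if (u.1.1 == 0) || (t <= tau_sigma u) then lin_flow t u
  else rot_flow (t - tau_sigma u) (hit_sigma u).

Definition before_return (u : R3 R) (t : R) : Prop :=
  0 <= t /\ (u.1.1 != 0 -> t <= return_time u).

Definition Lambda_geo : set (R3 R) :=
  [set v | exists u t, [/\ section_S u, before_return u t & v = loop_path u t]].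

(* path_from u t p: the concatenated path started at u in S is at p at time
   t. *)
Inductive path_from (u : R3 R) (t : R) : R3 R -> Prop :=
| path_loop of before_return u t : path_from u t (loop_path u t)
| path_return p of u.1.1 != 0 & return_time u <= t &
    path_from (return_map u) (t - return_time u) p : path_from u t p.

(* For admissible parameters paths do not cross, so for v in Lambda_geo and
   t >= 0 there is exactly one p as below. *)
Definition geo_flow (t : R) (v : R3 R) : R3 R :=
  xget v [set p | exists u s, [/\ section_S u, before_return u s,
                                 v = loop_path u s & path_from u (s + t) p]].

Definition colvec (u : R3 R) : 'cV[R]_3 :=
  \col_(j < 3) [:: u.1.1; u.1.2; u.2]`_j.

Definition opnorm (d : nat) (H : 'M[R]_(d, 3)) : R :=
  sup [set `|H *m x| | x in [set x : 'cV[R]_3 | `|x| <= 1]].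

Definition prob_density_on (D : set (R3 R)) (q : R3 R -> R) : Prop :=
  [/\ measurable_fun D q,
      (forall v, D v -> 0 <= q v)
    & (\int[lebesgue3]_(v in D) (q v)%:E = 1)%E].

Definition noise_pdf (d : nat) (eps : R) (z : 'cV[R]_d) : R :=
  \prod_(j < d) uniform_pdf (- eps) eps (z j 0).

(* Boxes generate the sigma-algebra of the d-tuples, so this determines the law
   of X. *)
Definition uniform_on_cube (dT : measure_display) (T : measurableType dT)
    (P : probability T R) (d : nat) (eps : R) (X : {RV P >-> d.-tuple R}) :
    Prop :=
  forall A : 'I_d -> set R, (forall j, measurable (A j)) ->
    P [set w | forall j, A j (tnth (X w) j)] =
    (\prod_(j < d)
       \int[@lebesgue_measure R]_(x in A j) (uniform_pdf (- eps) eps x)%:E)%E.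

Definition mutually_independent (dT : measure_display) (T : measurableType dT)
    (P : probability T R) (dE : measure_display) (E : measurableType dE)
    (X : nat -> {RV P >-> E}) : Prop :=
  forall (n : nat) (B : nat -> set E), (forall i, measurable (B i)) ->
    P [set w | forall i, (i < n)%N -> B i (X i w)] =
    (\prod_(i < n) P [set w | B i (X i w)])%E.

Section Smoothing.
Variables (d : nat) (H : 'M[R]_(d, 3)) (q : R3 R -> R) (eps h : R) (k : nat).

Definition observation (u : R3 R) (z : nat -> d.-tuple R) (i : nat) :
    'cV[R]_d :=
  H *m colvec (geo_flow (i%:R * h) u) + \col_(j < d) tnth (z i) j.

(* The positive constant C is left free rather than fixed by the normalisation
   of f: the support of f does not depend on it. *)
Definition smoothing_density (Y : nat -> 'cV[R]_d) (f : R3 R -> R) : Prop :=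
  exists2 C : R, 0 < C & forall v, Lambda_geo v ->
    f v = C * (q v *
      \prod_(i < k.+1)
        noise_pdf eps (Y i - H *m colvec (geo_flow (i%:R * h) v))).

End Smoothing.

Definition density_support (f : R3 R -> R) : set (R3 R) :=
  [set v | Lambda_geo v /\ f v != 0].

(* The maximum with 0 makes the diameter of the empty set equal to 0. *)
Definition diam (A : set (R3 R)) : \bar R :=
  maxe 0%E (ereal_sup [set (`|x.1 - x.2|)%:E | x in A `*` A]).

End GeometricModel.

(* Main.v *)
Require Import Defs.
From mathcomp Require Import all_boot all_order all_algebra.
From mathcomp Require Import all_classical all_reals all_analysis.
From mathcomp Require Import measurable_realfun ring lra.
Import Order.TTheory GRing.Theory Num.Theory.
Import numFieldNormedType.Exports.
Local Open Scope classical_set_scope.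
Local Open Scope ring_scope.

Set Implicit Arguments.
Unset Strict Implicit.
Unset Printing Implicit Defensive.

(** The linear flow contracts the second coordinate, and neither the linear
    nor the rotation phase lets it influence the other two: moving a point of
    [section_S] in the second coordinate changes neither the hitting times nor
    the first and third coordinates of its path, and the second coordinates of
    the two paths differ by the initial difference times
    [expR (- (lam2 m * L))], where [L] is the time spent so far in the linear
    phase.  Each loop spends at least [ln 2 / lam1 m] in the linear phase and
    exactly [rot_time] in the rotation phase, so [L] is at least a fixed
    fraction of the elapsed time, and the paths merge exponentially fast, at
    the rate [decay_rate] which depends on the parameters only.

    Hence next to a point [u] of [Lambda_geo m] there are points [v] at every
    small distance [D] whose path stays within
    [D * expR (decay_rate m * (rot_time - t))] of the path of [u] at every time
    [t] ([stable_neighbour]).  To turn this into a statement about [geo_flow]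
    one has to know that the path through a point is determined by the point,
    i.e. that paths do not cross ([loop_path_inj], [geo_flowE]): a point of the
    open rotation phase lies beyond [|u_1| = 1] or above [u_3 = 1], so it is not
    in the linear phase; seen along the second axis, the two rotation wings
    overlap only where [u_3 > 1], and there the second coordinate is negative on
    one and positive on the other;
    within one wing the polar coordinates around the axis of rotation recover
    the time and the starting point.

    Both [u] and [v] are in the support as soon as every noise coordinate at
    time [i * h] has absolute value at most [eps] minus the distance between
    the two noiseless observations, which is at most
    [opnorm H * D * expR (decay_rate m * (rot_time - i * h))].  Each of these
    events fails with probability at most that distance over [eps].  The
    distances form a geometric series whose sum is of order
    [opnorm H * D / h] whatever the number of observations, so by the union
    bound ([union_tail]) a distance [D] of order [h * eps / opnorm H] makes
    the total probability of failure at most one half.  With probability at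
    least one half the diameter is therefore at least [D], and its
    expectation at least [D / 2]. *)

(** * Trigonometry of the rotation phase *)

Section Trigonometry.
Context {R : realType}.
Implicit Types x y s r : R.

Lemma rot_time_gt0 : 0 < rot_time :> R.
Proof. by rewrite /rot_time; have := pi_gt0 R; lra. Qed.

Lemma sin_rot_time : sin (rot_time : R) = -1.
Proof.
have -> : rot_time = pi / 2 + pi :> R by rewrite /rot_time; lra.
by rewrite sinDpi sin_pihalf.
Qed.

Lemma cos_rot_time : cos (rot_time : R) = 0.
Proof.
have -> : rot_time = pi / 2 + pi :> R by rewrite /rot_time; lra.
by rewrite cosDpi cos_pihalf oppr0.
Qed.

(** By the half-angle formula [sin (`|x| / 2)] vanishes, while [`|x| / 2] is
    below [pi]. *)
Lemma cos_eq1 x : cos x = 1 -> `|x| < 2 * pi -> x = 0.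
Proof.
move=> cx xpi; apply/eqP; rewrite -normr_eq0; apply/eqP.
have [//|x0] := eqVneq `|x| 0.
have px : 0 < `|x| by rewrite lt0r x0 normr_ge0.
have sx : 0 < sin (`|x| / 2) by apply: sin_gt0_pi; lra.
have := cos_mulr2n (`|x| / 2); have -> : `|x| / 2 *+ 2 = `|x| by lra.
rewrite cos_norm cx cos2sin2 => E.
have : 0 < sin (`|x| / 2) ^+ 2 by rewrite exprn_gt0.
by lra.
Qed.

(** Summing squares gives equal radii; then [cos (s - s') = 1], and
    [rot_time], three quarters of a turn, leaves no room for a full turn
    between [s] and [s']. *)
Lemma polar_inj r r' s s' : 0 < r -> 0 < r' -> 0 < s < rot_time ->
    0 < s' < rot_time -> r * sin s = r' * sin s' -> r * cos s = r' * cos s' ->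
  r = r' /\ s = s'.
Proof.
move=> r0 r'0 /andP[s0 sT] /andP[s'0 s'T] ES EC.
have rr' : r = r'.
  apply/eqP; rewrite -(eqrXn2 (_ : (0 < 2)%N)) ?ltW//; apply/eqP.
  rewrite -[LHS]mulr1 -(cos2Dsin2 s) -[RHS]mulr1 -(cos2Dsin2 s').
  by rewrite !mulrDr -!exprMn ES EC.
split => //; subst r'.
have Es : sin s = sin s' by apply: (mulfI (lt0r_neq0 r0)).
have Ec : cos s = cos s' by apply: (mulfI (lt0r_neq0 r0)).
apply/eqP; rewrite -subr_eq0; apply/eqP/cos_eq1.
  by rewrite cosB Es Ec -!expr2 cos2Dsin2.
rewrite ltr_norml; move: sT s'T; rewrite /rot_time => sT s'T.
by have := pi_gt0 R; lra.
Qed.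

(** The arc starts below the centre and makes three quarters of a
    turn: its first half turn lies to the right of the centre and its last
    quarter above it. *)
Lemma rot_arc r s : 0 < r -> 0 < s < rot_time ->
  [/\ s <= pi -> 1 <= 1 + r * sin s, pi < s -> 1 < 1 - r * cos s
    & 1 < 1 + r * sin s \/ 1 < 1 - r * cos s].
Proof.
move=> r0 /andP[s0]; rewrite /rot_time => sT.
have cs : pi < s -> 1 < 1 - r * cos s.
  move=> pis; rewrite ltrDl -mulrN mulr_gt0//.
  rewrite -[s](subrK pi) cosDpi opprK.
  by apply: cos_gt0_pihalf; have := pi_gt0 R; lra.
have ss : s < pi -> 1 < 1 + r * sin s.
  by move=> spi; rewrite ltrDl mulr_gt0// sin_gt0_pi// s0.
split => //.
- rewrite le_eqVlt => /orP[/eqP ->|/ss/ltW//].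
  by rewrite sinpi mulr0 addr0.
- case: (ltgtP s pi) => [/ss|/cs|->]; [by left|by right|right].
  by rewrite cospi mulrN1 opprK ltrDl.
Qed.

End Trigonometry.

(** * Parameters and hitting times *)

Section Model.
Context {R : realType} (m : lorenz_param R) (adm : admissible m).
Implicit Types (u v p : R3 R) (t s h D : R).

Local Notation T := (@rot_time R).

Lemma lam1_gt0 : 0 < lam1 m.
Proof. by case: adm => -[l3 l13 _] _; exact: lt_trans l13. Qed.

Lemma lam2_gt0 : 0 < lam2 m.
Proof. by case: adm => -[_ _ l12] _; exact: lt_trans lam1_gt0 l12. Qed.

Lemma lam3_gt0 : 0 < lam3 m.
Proof. by case: adm => -[]. Qed.

Lemma alpha_gt0 : 0 < alpha m.
Proof. by rewrite divr_gt0 ?lam3_gt0 ?lam1_gt0. Qed.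

Lemma beta_gt0 : 0 < beta m.
Proof. by rewrite divr_gt0 ?lam2_gt0 ?lam1_gt0. Qed.

Lemma theta_gt0 : 0 < theta m.
Proof.
case: adm => _ [_ _ _ lt_th _]; apply: lt_trans lt_th.
by rewrite divr_gt0 ?powR_gt0// mulr_gt0 ?sqrtr_gt0 ?alpha_gt0.
Qed.

Lemma powR_half x : 2^-1 `^ x = (2 `^ x)^-1 :> R.
Proof. by rewrite -powR_inv1// -powRrM mulN1r powRN. Qed.

(** This is where [theta m < 2 `^ alpha m] enters: it keeps the
    first coordinate of the return map within [section_S] and the radius of
    rotation positive. *)
Lemma theta_powR_lt1 x : 0 < x <= 2^-1 -> theta m * x `^ alpha m < 1.
Proof.
move=> /andP[x0 x2]; apply: (@le_lt_trans _ _ (theta m * 2^-1 `^ alpha m)).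
  rewrite ler_pM2l ?theta_gt0//.
  by apply: (ge0_ler_powR (ltW alpha_gt0)); rewrite ?nnegrE ?invr_ge0// ltW.
rewrite powR_half ltr_pdivrMr ?powR_gt0// mul1r.
by case: adm => _ [].
Qed.

(** The bound on [beta m] says [6 < 2 `^ (beta m + 1)].  With
    [`|u_2| <= 1 / 2] the factor [1 / 3] yields [`|u_2| < 1 / 6] on leaving
    the linear phase, and the drift of the second coordinate, which is
    [1 / 6] after two thirds of the rotation, then separates the two wings. *)
Lemma powR_beta_lt x : 0 < x <= 2^-1 -> x `^ beta m < 3^-1.
Proof.
move=> /andP[x0 x2]; apply: (@le_lt_trans _ _ (2^-1 `^ beta m)).
  by apply: (ge0_ler_powR (ltW beta_gt0)); rewrite ?nnegrE ?invr_ge0// ltW.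
rewrite powR_half ltf_pV2 ?posrE ?powR_gt0//.
have ln2 : 0 < ln 2 :> R by rewrite ln_gt0// ltr1n.
rewrite -ltr_ln ?posrE ?powR_gt0// ln_powR.
case: adm => _ [_ _ + _ _]; rewrite ltrBlDr ltr_pdivrMr// mulrDl mul1r.
rewrite (_ : 6 = 3 * 2) -?natrM// natrM lnM ?posrE//.
by rewrite ltrD2r.
Qed.

Lemma powR_alpha_lt1 x : 0 < x <= 2^-1 -> x `^ alpha m < 1.
Proof.
move=> /andP[x0 x2].
have := @gt0_ltr_powR _ _ alpha_gt0 x 1; rewrite powR1; apply;
  rewrite ?nnegrE//; lra.
Qed.

Lemma abs_u1_section u : section_S u -> u.1.1 != 0 -> 0 < `|u.1.1| <= 2^-1.
Proof. by case=> -> _ _ u0; rewrite normr_gt0 u0. Qed.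

Section OffGamma.
Context u (Su : section_S u) (u0 : u.1.1 != 0).

Let abs_u := abs_u1_section Su u0.

Lemma tau_sigma_ge : ln 2 / lam1 m <= tau_sigma m u.
Proof.
rewrite /tau_sigma mulrC ler_pM2l ?invr_gt0 ?lam1_gt0//.
case/andP: abs_u => a0 a2.
by rewrite ler_ln ?posrE ?invr_gt0// -[leLHS]invrK lef_pV2 ?posrE ?invr_gt0.
Qed.

Lemma ln_abs : ln `|u.1.1| = - (lam1 m * tau_sigma m u).
Proof.
rewrite /tau_sigma mulrA divff ?gt_eqF ?lam1_gt0// mul1r lnV ?opprK// posrE.
by case/andP: abs_u.
Qed.

Lemma expR_tau1 : expR (lam1 m * tau_sigma m u) = `|u.1.1|^-1.
Proof.
by rewrite -[X in expR X]opprK -ln_abs expRN lnK// posrE; case/andP: abs_u.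
Qed.

Lemma expR_tau_powR l : expR (- (l * tau_sigma m u)) = `|u.1.1| `^ (l / lam1 m).
Proof.
rewrite /powR normr_eq0 (negbTE u0) ln_abs; congr expR.
have : lam1 m != 0 by rewrite gt_eqF ?lam1_gt0.
by move=> ?; field.
Qed.

End OffGamma.

(** * The rotation phase and the return map *)

Lemma rot_fraction s : 0 <= s <= T -> 0 <= s / T <= 1.
Proof.
move=> /andP[s0 sT]; rewrite divr_ge0 ?(ltW rot_time_gt0)//=.
by rewrite ler_pdivrMr ?rot_time_gt0// mul1r.
Qed.

(** The radius interpolates linearly between [1 - w3], on leaving the linear
    phase, and [3 / 2 - theta m * w3], on reaching [section_S]. *)
Lemma rot_radiusE s w3 : rot_radius m s w3 =
  (1 - s / T) * (1 - w3) + s / T * (3 / 2 - theta m * w3).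
Proof. by rewrite /rot_radius; move: (s / T) => x; field. Qed.

Lemma rot_radius_bound s w3 : 0 <= s <= T -> 0 < w3 < 1 -> theta m * w3 < 1 ->
  0 < rot_radius m s w3 <= 3 / 2.
Proof.
move=> /rot_fraction; rewrite rot_radiusE; move: (s / T) => x x01 w01 tw.
have : 0 < theta m * w3 by rewrite mulr_gt0 ?theta_gt0//; case/andP: w01.
by move: tw; move: (theta m * w3) => y *; apply/andP; split; nra.
Qed.

Lemma rot_radius_inj s : 0 <= s <= T -> injective (rot_radius m s).
Proof.
move=> /rot_fraction; rewrite /rot_radius; move: (s / T) => x x01 w w' /eqP.
have th := theta_gt0; rewrite -subr_eq0 => /eqP E; apply/eqP.
rewrite -subr_eq0; apply/eqP.
have : (1 - x + theta m * x) * (w - w') = 0 by rewrite -[RHS]oppr0 -E; ring.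
by move=> /eqP; rewrite mulf_eq0 => /orP[/eqP|/eqP//]; nra.
Qed.

(** Writing both wings with the sign of [u_1] lets the proofs below treat them
    at once. *)
Lemma rot_flow_hit u s : u.1.1 != 0 ->
  let r := rot_radius m s (`|u.1.1| `^ alpha m) in
  rot_flow m s (hit_sigma m u) =
  (Num.sg u.1.1 * (1 + r * sin s),
   u.1.2 * `|u.1.1| `^ beta m - Num.sg u.1.1 * (4^-1 * (s / T)), 1 - r * cos s).
Proof.
rewrite /rot_flow /hit_sigma /=; case: sgrP => // _ _.
  by rewrite eqxx !mul1r.
rewrite (_ : (-1 == 1 :> R) = false) ?mulN1r ?opprK ?opprD//.
by apply/negbTE/eqP; lra.
Qed.

Lemma return_mapE u : u.1.1 != 0 ->
  return_map m u = (Num.sg u.1.1 * (theta m * `|u.1.1| `^ alpha m - 2^-1),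
                    u.1.2 * `|u.1.1| `^ beta m - Num.sg u.1.1 * 4^-1, 1).
Proof.
move=> u0; rewrite /return_map rot_flow_hit// sin_rot_time cos_rot_time.
rewrite rot_radiusE divff ?gt_eqF ?rot_time_gt0//.
by congr (_, _, _); field.
Qed.

Lemma abs_exit_u2_lt u : section_S u -> u.1.1 != 0 ->
  `|u.1.2 * `|u.1.1| `^ beta m| < 6^-1.
Proof.
move=> Su u0; have := powR_beta_lt (abs_u1_section Su u0).
have : 0 < `|u.1.1| `^ beta m by rewrite powR_gt0// normr_gt0.
case: Su => _ ? _ ? ?; rewrite normrM (@ger0_norm _ (_ `^ _)) ?powR_ge0//.
by nra.
Qed.

Lemma section_return_map u : section_S u -> u.1.1 != 0 ->
  section_S (return_map m u).
Proof.
move=> Su u0; rewrite return_mapE//; have := abs_exit_u2_lt Su u0.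
have := theta_powR_lt1 (abs_u1_section Su u0).
have := theta_gt0; have : 0 < `|u.1.1| `^ alpha m by rewrite powR_gt0 ?normr_gt0.
have ns : `|Num.sg u.1.1| = 1 by rewrite normr_sg u0.
move=> a0 th0 tha w2; split => //=.
  by rewrite normrM ns mul1r ler_norml; nra.
apply: le_trans (ler_normB _ _) _; rewrite (normrM (Num.sg _)) ns mul1r.
by rewrite ger0_norm//; lra.
Qed.

Lemma tau_sigma_gt0 u : section_S u -> u.1.1 != 0 -> 0 < tau_sigma m u.
Proof.
move=> Su u0; apply: lt_le_trans (tau_sigma_ge Su u0).
by rewrite divr_gt0 ?lam1_gt0// ln_gt0// ltr1n.
Qed.

Lemma return_time_gt0 u : section_S u -> u.1.1 != 0 -> 0 < return_time m u.
Proof. by move=> Su u0; rewrite addr_gt0 ?tau_sigma_gt0 ?rot_time_gt0. Qed.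

Lemma loop_path0 u : section_S u -> loop_path m u 0 = u.
Proof.
move=> Su; rewrite /loop_path; case: eqVneq => /= u0.
  by rewrite /lin_flow !mulr0 !oppr0 expR0 !mulr1 -!surjective_pairing.
rewrite ltW ?tau_sigma_gt0// /lin_flow.
by rewrite !mulr0 !oppr0 expR0 !mulr1 -!surjective_pairing.
Qed.

Lemma loop_path_return u : section_S u -> u.1.1 != 0 ->
  loop_path m u (return_time m u) = return_map m u.
Proof.
move=> Su u0; rewrite /loop_path (negbTE u0) /= /return_time gerDl leNgt.
by rewrite rot_time_gt0 /= addrAC subrr add0r.
Qed.

(** * Paths do not cross *)

(** The return time is left out: the point reached then belongs to the next
    loop, where it has time 0. *)
Definition in_loop u t := 0 <= t /\ (u.1.1 != 0 -> t < return_time m u).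

(** Together with [rot_phase_exit] this separates the two phases. *)
Lemma lin_phase_bound u t : section_S u -> 0 <= t ->
    (u.1.1 == 0) || (t <= tau_sigma m u) ->
  `|(loop_path m u t).1.1| <= 1 /\ (loop_path m u t).2 <= 1.
Proof.
move=> Su t0 lin; rewrite /loop_path lin /=; split; last first.
  have [_ _ ->] := Su.
  by rewrite mul1r expR_le1 oppr_le0 mulr_ge0// ltW// lam3_gt0.
case: (eqVneq u.1.1 0) lin => [->|u0 /= tt]; first by rewrite mul0r normr0.
rewrite normrM (@ger0_norm _ (expR _)) ?expR_ge0//.
apply: (@le_trans _ _ (`|u.1.1| * expR (lam1 m * tau_sigma m u))).
  by rewrite ler_wpM2l// ler_expR ler_pM2l ?lam1_gt0.
by rewrite expR_tau1// divff// normr_eq0.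
Qed.

Lemma rot_phase_bound u s : section_S u -> u.1.1 != 0 -> 0 <= s <= T ->
  0 < rot_radius m s (`|u.1.1| `^ alpha m) <= 3 / 2.
Proof.
move=> Su u0 sT; have au := abs_u1_section Su u0; apply: rot_radius_bound => //.
  by rewrite powR_gt0 ?normr_gt0//= powR_alpha_lt1.
exact: theta_powR_lt1.
Qed.

Lemma rot_phase_exit u s : section_S u -> u.1.1 != 0 -> 0 < s < T ->
  1 < `|(rot_flow m s (hit_sigma m u)).1.1| \/
  1 < (rot_flow m s (hit_sigma m u)).2.
Proof.
move=> Su u0 sT; rewrite rot_flow_hit//=.
have /andP[r0 _] : 0 < rot_radius m s (`|u.1.1| `^ alpha m) <= 3 / 2.
  by apply: rot_phase_bound => //; case/andP: sT => /ltW-> /ltW.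
have [_ _ [h|h]] := rot_arc r0 sT; [left|by right].
by rewrite normrM normr_sg u0 mul1r; apply: lt_le_trans h (ler_norm _).
Qed.

(** During the first half turn the right wing has [u_1 >= 1], which the left
    wing never reaches since its radius is at most [3 / 2], and symmetrically.
    After two thirds of the rotation time, i.e. beyond [s = pi], the drift
    exceeds [1 / 6] and gives the second coordinates opposite signs. *)
Lemma wings_disjoint u v s t : section_S u -> section_S v ->
    0 < u.1.1 -> v.1.1 < 0 -> 0 < s < T -> 0 < t < T ->
  rot_flow m s (hit_sigma m u) <> rot_flow m t (hit_sigma m v).
Proof.
move=> Su Sv u0 v0 sT tT.
have u1 : u.1.1 != 0 by rewrite gt_eqF.
have v1 : v.1.1 != 0 by rewrite lt_eqF.
rewrite !rot_flow_hit// (gtr0_sg u0) (ltr0_sg v0) !mul1r.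
have := abs_exit_u2_lt Su u1; have := abs_exit_u2_lt Sv v1; rewrite !ltr_norml.
move: (_ * _ `^ beta m) (_ * _ `^ beta m) => wu wv wub wvb [].
have /andP[] : 0 < rot_radius m s (`|u.1.1| `^ alpha m) <= 3 / 2.
  by apply: rot_phase_bound => //; case/andP: sT => /ltW-> /ltW.
have /andP[] : 0 < rot_radius m t (`|v.1.1| `^ alpha m) <= 3 / 2.
  by apply: rot_phase_bound => //; case/andP: tT => /ltW-> /ltW.
move: (rot_radius m s _) (rot_radius m t _) => r r' r'0 r'2 r0 r2 E1 E2 _.
have [hs _ _] := rot_arc r0 sT; have [ht _ _] := rot_arc r'0 tT.
have ge_s x y : 0 < y -> y <= 3 / 2 -> - (1 / 2) <= 1 + y * sin x :> R.
  by move=> y0 y2; have := sin_geN1 x; nra.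
case: (leP s pi) => [/hs sp|sp]; first by have := ge_s t r' r'0 r'2; lra.
case: (leP t pi) => [/ht tp|tp]; first by have := ge_s s r r0 r2; lra.
have frac (x : R) : pi < x -> 2 / 3 < x / T.
  move=> xp; rewrite ltr_pdivlMr ?rot_time_gt0// /rot_time.
  by rewrite (_ : 2 / 3 * _ = pi)//; field.
by have := frac _ sp; have := frac _ tp; lra.
Qed.

(** In the linear phase the third coordinate [expR (- (lam3 m * t))] gives
    the time; in the rotation phase polar coordinates give the time and the
    radius, and the radius gives [`|u_1|]. *)
Lemma loop_path_inj u v s t : section_S u -> section_S v ->
    in_loop u s -> in_loop v t -> loop_path m u s = loop_path m v t ->
  u = v /\ s = t.
Proof.
move=> Su Sv [s0 sR] [t0 tR].
have rotT w x : ~~ ((w.1.1 == 0) || (x <= tau_sigma m w)) ->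
    (w.1.1 != 0 -> x < return_time m w) ->
    w.1.1 != 0 /\ 0 < x - tau_sigma m w < T.
  rewrite negb_or -ltNge => /andP[w0 wx] /(_ w0); rewrite /return_time.
  by split=> //; lra.
have [lu|/[dup] nlu /rotT/(_ sR)[u0 sT]] :=
    boolP ((u.1.1 == 0) || (s <= tau_sigma m u));
  have [lv|/[dup] nlv /rotT/(_ tR)[v0 tT]] :=
    boolP ((v.1.1 == 0) || (t <= tau_sigma m v)).
- rewrite /loop_path lu lv /lin_flow => -[E1 E2 E3].
  have st : s = t.
    move: E3; case: Su Sv => _ _ -> [_ _ ->].
    rewrite !mul1r => /expR_inj/oppr_inj.
    by apply: mulfI; rewrite gt_eqF ?lam3_gt0.
  split => //; subst t; case: Su Sv => _ _ u3 [_ _ v3].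
  move: (mulIf (negbT (expR_eq0 _)) E1) (mulIf (negbT (expR_eq0 _)) E2).
  by move: u3 v3; case: (u) (v) => -[? ?] ? [[? ?] ?] /= -> -> -> ->.
- move=> E; have [] := lin_phase_bound Su s0 lu; rewrite E.
  rewrite /loop_path (negbTE nlv).
  by case: (rot_phase_exit Sv v0 tT); lra.
- move=> E; have [] := lin_phase_bound Sv t0 lv; rewrite -E.
  rewrite /loop_path (negbTE nlu).
  by case: (rot_phase_exit Su u0 sT); lra.
rewrite /loop_path (negbTE nlu) (negbTE nlv).
have sg_neg : Num.sg u.1.1 != Num.sg v.1.1 ->
    rot_flow m (s - tau_sigma m u) (hit_sigma m u) <>
    rot_flow m (t - tau_sigma m v) (hit_sigma m v).
  case: (ltgtP u.1.1 0) u0 => // uu _; case: (ltgtP v.1.1 0) v0 => // vv _.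
  - by rewrite !ltr0_sg ?eqxx.
  - by move=> _ /esym; exact: wings_disjoint.
  - by move=> _; exact: wings_disjoint.
  - by rewrite !gtr0_sg ?eqxx.
have [sguv {sg_neg}|/sg_neg//] := eqVneq (Num.sg u.1.1) (Num.sg v.1.1).
have := rot_phase_bound Su u0; have := rot_phase_bound Sv v0.
have sg0 : Num.sg v.1.1 != 0 by rewrite sgr_eq0.
move=> /(_ (t - tau_sigma m v)) Hv /(_ (s - tau_sigma m u)) Hu.
have {Hu} /andP[ru0 _] := Hu ltac:(by case/andP: sT => /ltW-> /ltW).
have {Hv} /andP[rv0 _] := Hv ltac:(by case/andP: tT => /ltW-> /ltW).
rewrite !rot_flow_hit// sguv => -[/(mulfI sg0)/addrI E1 E2 /addrI/oppr_inj E3].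
have [rr ss] := polar_inj ru0 rv0 sT tT E1 E3.
have au : `|u.1.1| = `|v.1.1|.
  apply: (powR_injective alpha_gt0); rewrite ?nnegrE//.
  move: rr; rewrite ss; apply: rot_radius_inj.
  by case/andP: tT => /ltW-> /ltW.
have u11 : u.1.1 = v.1.1 by rewrite (numEsg u.1.1) sguv au -numEsg.
have u12 : u.1.2 = v.1.2.
  move: E2; rewrite ss au => /addIr; apply: mulIf.
  by rewrite gt_eqF// powR_gt0// normr_gt0.
have uv : u = v.
  case: Su Sv => _ _ u3 [_ _ v3]; move: u11 u12 u3 v3.
  by case: (u) (v) => -[? ?] ? [[? ?] ?] /= -> -> -> ->.
by split => //; move: ss; rewrite uv => /addIr.
Qed.

(** * The semigroup of concatenated paths *)

Lemma path_from0 u p : section_S u -> path_from m u 0 p -> p = u.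
Proof.
move=> Su E; inversion E as [|? u0 R0]; first exact: loop_path0.
by move: (return_time_gt0 Su u0); rewrite ltNge R0.
Qed.

(** At [t = return_time m u] both constructors of [path_from] apply; this
    lets the path be continued in the next loop in that case too. *)
Lemma path_at_return u t p : section_S u -> u.1.1 != 0 ->
    return_time m u <= t -> path_from m u t p ->
  path_from m (return_map m u) (t - return_time m u) p.
Proof.
move=> Su u0 Rt E; inversion E as [rt|]; last by [].
case: rt => t0 /(_ u0) tR.
have -> : t = return_time m u by lra.
rewrite subrr loop_path_return// -[X in path_from _ _ _ X]loop_path0; last first.
  exact: section_return_map.
apply: path_loop; split=> // ru0; apply/ltW/return_time_gt0 => //.
exact: section_return_map.
Qed.

(** The two constructors overlap only at the return time, where they agree. *)
Lemma path_from_unique u t p q : section_S u ->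
  path_from m u t p -> path_from m u t q -> p = q.
Proof.
move=> Su Ep; elim: Ep q Su => {u t p} [u t [t0 tR]|u t p u0 Rt _ IH] q Su Eq.
  inversion Eq as [|? u0 Rt Eq']; first by [].
  have tE : t = return_time m u by have := tR u0; lra.
  move: Eq'; rewrite tE subrr => /(path_from0 (section_return_map Su u0)) ->.
  exact: loop_path_return.
by apply: IH; [exact: section_return_map|exact: path_at_return].
Qed.

(** Each loop takes longer than [rot_time], so a bounded number of loops covers
    [t]. *)
Lemma path_from_exists u t : section_S u -> 0 <= t ->
  exists p, path_from m u t p.
Proof.
move=> Su t0.
have [n] : exists n : nat, t < n%:R * T.
  exists (Num.truncn (t / T)).+1; rewrite -ltr_pdivrMr ?rot_time_gt0//.
  by rewrite truncnS_gt.
elim: n u t Su t0 => [|n IH] u t Su t0 tn; first by lra.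
have [u0|u0] := eqVneq u.1.1 0.
  by exists (loop_path m u t); apply: path_loop; split=> //; rewrite u0 eqxx.
have [tR|/ltW Rt] := leP t (return_time m u).
  by exists (loop_path m u t); apply: path_loop.
have Sru := section_return_map Su u0.
have [||p Ep] := IH (return_map m u) (t - return_time m u) Sru.
- by lra.
- have := tau_sigma_gt0 Su u0; move: tn.
  by rewrite -addn1 natrD mulrDl mul1r /return_time; lra.
by exists p; apply: path_return.
Qed.

(** A point met exactly at the return time is moved to the start of the next
    loop, so that [loop_path_inj] applies. *)
Lemma half_open_loop u s : section_S u -> before_return m u s ->
  exists u' s', [/\ section_S u', in_loop u' s',
      loop_path m u s = loop_path m u' s'
    & forall t p, 0 <= t -> path_from m u (s + t) p ->
        path_from m u' (s' + t) p].
Proof.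
move=> Su [s0 sR].
have [/andP[u0 /eqP sE]|] := boolP ((u.1.1 != 0) && (s == return_time m u)).
  exists (return_map m u), 0; have Sru := section_return_map Su u0; split => //.
  - by split => // ?; exact: return_time_gt0.
  - by rewrite sE loop_path_return// loop_path0.
  - move=> t p t0 /(path_at_return Su u0); rewrite sE lerDl add0r => /(_ t0).
    by rewrite addrAC subrr add0r.
rewrite negb_and negbK => ns; exists u, s; split=> //; split=> // u0.
by move: ns; rewrite (negbTE u0) /= lt_neqAle => ->; exact: sR.
Qed.

(** The choice made in [geo_flow] is harmless: any two representations of a
    point have the same half-open form, hence the same continuation. *)
Lemma geo_flowE u s t p : section_S u -> before_return m u s -> 0 <= t ->
  path_from m u (s + t) p -> geo_flow m t (loop_path m u s) = p.
Proof.
move=> Su us t0 Ep; apply: xget_subset1; first by exists u, s.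
move=> p1 p2 [u1 [s1 [Su1 us1 E1 Ep1]]] [u2 [s2 [Su2 us2 E2 Ep2]]].
have [v1 [r1 [Sv1 vr1 F1 /(_ _ _ t0 Ep1) Fp1]]] := half_open_loop Su1 us1.
have [v2 [r2 [Sv2 vr2 F2 /(_ _ _ t0 Ep2) Fp2]]] := half_open_loop Su2 us2.
have F12 : loop_path m v1 r1 = loop_path m v2 r2 by rewrite -F1 -E1 E2.
have [vE rE] := loop_path_inj Sv1 Sv2 vr1 vr2 F12.
by subst v2 r2; exact: path_from_unique Fp1 Fp2.
Qed.

(** * Contraction along the second coordinate *)

Definition shift2 D p : R3 R := (p.1.1, p.1.2 + D, p.2).

(** The part of the first [t] time units that the path from [u] spends in the
    linear phase, for [t] up to the first return. *)
Definition lin_time u t : R :=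
  if (u.1.1 == 0) || (t <= tau_sigma m u) then t else tau_sigma m u.

(** [lam2 m] times the smallest possible fraction of a loop that is spent in
    the linear phase: the first coordinate has to grow from at most [1 / 2] to
    1, which takes at least [ln 2 / lam1 m]. *)
Definition decay_rate : R :=
  lam2 m * ((ln 2 / lam1 m) / (ln 2 / lam1 m + T)).

Lemma min_lin_time_gt0 : 0 < ln 2 / lam1 m.
Proof. by rewrite divr_gt0 ?lam1_gt0// ln_gt0// ltr1n. Qed.

Lemma decay_rate_gt0 : 0 < decay_rate.
Proof.
have t0 := min_lin_time_gt0; rewrite mulr_gt0 ?lam2_gt0// divr_gt0//.
by rewrite addr_gt0// rot_time_gt0.
Qed.

Lemma decay_rate_le : decay_rate <= lam2 m.
Proof.
have t0 := min_lin_time_gt0; have T0 := @rot_time_gt0 R.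
rewrite ler_piMr ?(ltW lam2_gt0)// ler_pdivrMr; lra.
Qed.

Lemma decay_return u : section_S u -> u.1.1 != 0 ->
  decay_rate * return_time m u <= lam2 m * tau_sigma m u.
Proof.
move=> Su u0; have := tau_sigma_ge Su u0; have := min_lin_time_gt0.
have T0 := @rot_time_gt0 R.
rewrite /decay_rate /return_time -mulrA ler_pM2l ?lam2_gt0//.
move: (ln 2 / lam1 m) (tau_sigma m u) T0 => x y T0 x0 xy.
rewrite mulrAC ler_pdivrMr ?addr_gt0// mulrDr mulrDr mulrC lerD2l.
by rewrite ler_pM2r.
Qed.

Lemma expR_lam2_tau u : section_S u -> u.1.1 != 0 ->
  `|u.1.1| `^ beta m = expR (- (lam2 m * tau_sigma m u)).
Proof. by move=> Su u0; rewrite expR_tau_powR. Qed.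

Lemma loop_path_shift u D t : section_S u ->
  loop_path m (shift2 D u) t =
  shift2 (D * expR (- (lam2 m * lin_time u t))) (loop_path m u t).
Proof.
move=> Su; rewrite /loop_path /lin_time [tau_sigma _ (shift2 _ _)]/tau_sigma /=.
rewrite -/(tau_sigma m u); case: ifPn => [_|].
  by rewrite /shift2 /lin_flow /= mulrDl.
rewrite negb_or => /andP[u0 _]; rewrite !rot_flow_hit//= /shift2 /=.
by congr (_, _, _); rewrite -expR_lam2_tau// mulrDl addrAC.
Qed.

Lemma return_map_shift u D : section_S u -> u.1.1 != 0 ->
  return_map m (shift2 D u) =
  shift2 (D * expR (- (lam2 m * tau_sigma m u))) (return_map m u).
Proof.
move=> Su u0; rewrite !return_mapE//= /shift2 /=.
by rewrite -expR_lam2_tau// mulrDl addrAC.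
Qed.

(** During an interval of length [t] inside one loop, at most [rot_time] is
    spent in the rotation phase. *)
Lemma lin_time_increment u s t : section_S u -> 0 <= s -> 0 <= t ->
    before_return m u (s + t) ->
  lam2 m * lin_time u s + decay_rate * (t - T) <= lam2 m * lin_time u (s + t).
Proof.
move=> Su s0 t0 [_ stR].
have g0 := decay_rate_gt0; have gl := decay_rate_le; have T0 := @rot_time_gt0 R.
rewrite /lin_time; have [u0|u0] /= := eqVneq u.1.1 0; first by nra.
have := stR u0; rewrite /return_time; move: (tau_sigma m u) => x stx.
case: (leP s x) => sx; case: (leP (s + t) x) => tx; first by nra.
- have : 0 <= decay_rate * (x + T - (s + t)) by rewrite mulr_ge0 ?(ltW g0)//; lra.
  have : 0 <= (lam2 m - decay_rate) * (x - s) by rewrite mulr_ge0; lra.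
  by lra.
- by lra.
- have : 0 <= decay_rate * (T - t) by rewrite mulr_ge0 ?(ltW g0)//; lra.
  by lra.
Qed.

Lemma decay_rate_lin_time u t : section_S u -> before_return m u t ->
  decay_rate * t <= lam2 m * lin_time u t.
Proof.
move=> Su [t0 tR].
have g0 := decay_rate_gt0; have gl := decay_rate_le.
rewrite /lin_time; have [u0|u0] /= := eqVneq u.1.1 0; first by nra.
case: (leP t) => _; first by nra.
by apply: (le_trans _ (decay_return Su u0)); rewrite ler_pM2l//; exact: tR.
Qed.

(** The bound has no constant in front, so that it can be iterated over the
    loops; this needs the path to start in [section_S], where the linear phase
    comes first. *)
Lemma path_from_shift u t p D : section_S u -> section_S (shift2 D u) ->
    path_from m u t p ->
  exists2 D', path_from m (shift2 D u) t (shift2 D' p)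
            & `|D'| <= `|D| * expR (- (decay_rate * t)).
Proof.
move=> Su SDu Ep.
elim: Ep D Su SDu => {u t p} [u t ut|u t p u0 Rt _ IH] D Su SDu.
  exists (D * expR (- (lam2 m * lin_time u t))).
    by rewrite -loop_path_shift//; exact: path_loop.
  rewrite normrM (@ger0_norm _ (expR _)) ?expR_ge0// ler_wpM2l//.
  by rewrite ler_expR lerN2 decay_rate_lin_time.
have SDr := section_return_map SDu u0; rewrite return_map_shift// in SDr.
have [D' ED' bD'] := IH _ (section_return_map Su u0) SDr.
exists D'; first by apply: path_return => //; rewrite return_map_shift.
apply: le_trans bD' _; rewrite normrM (@ger0_norm _ (expR _)) ?expR_ge0//.
rewrite -mulrA ler_wpM2l// -expRD ler_expR.
by have := decay_return Su u0; rewrite mulrBr; lra.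
Qed.

(** Seen from a time [s] in the middle of a loop, where the difference is
    [`|D| * expR (- (lam2 m * lin_time u s))], the contraction may be delayed by
    the rest of one rotation phase. *)
Lemma path_from_shift_midloop u s t p D :
    section_S u -> section_S (shift2 D u) ->
    before_return m u s -> 0 <= t -> path_from m u (s + t) p ->
  exists2 D', path_from m (shift2 D u) (s + t) (shift2 D' p)
    & `|D'| <= `|D| * expR (- (lam2 m * lin_time u s)) *
               expR (decay_rate * (T - t)).
Proof.
move=> Su SDu us t0 Ep; have g0 := decay_rate_gt0; have gl := decay_rate_le.
inversion Ep as [ut|p' u0 Rt Ep']; [case: us => s0 _|].
  exists (D * expR (- (lam2 m * lin_time u (s + t)))).
    by rewrite -loop_path_shift//; exact: path_loop.
  rewrite normrM (@ger0_norm _ (expR _)) ?expR_ge0// -mulrA ler_wpM2l//.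
  rewrite -expRD ler_expR; have := lin_time_increment Su s0 t0 ut.
  by rewrite !mulrBr; lra.
have SDr := section_return_map SDu u0; rewrite return_map_shift// in SDr.
have [D' ED' bD'] := path_from_shift (section_return_map Su u0) SDr Ep'.
exists D'; first by apply: path_return => //; rewrite return_map_shift.
apply: le_trans bD' _; rewrite normrM (@ger0_norm _ (expR _)) ?expR_ge0//.
rewrite -!(mulrA `|D|) ler_wpM2l// -!expRD ler_expR.
rewrite /return_time /lin_time (negbTE u0) /=.
move: (tau_sigma m u) => x; case: (leP s x) => sx; last first.
  have : 0 <= decay_rate * (s - x) by rewrite mulr_ge0 ?(ltW g0)//; lra.
  by lra.
have : 0 <= (lam2 m - decay_rate) * (x - s) by rewrite mulr_ge0; lra.
by lra.
Qed.

(** The neighbour is obtained by moving the point of [section_S] from which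
    [u] comes.  The size of the move is [D] enlarged by the contraction between
    [section_S] and [u]; this is why [D] has to be small in terms of [u]. *)
Lemma stable_neighbour u : Lambda_geo m u ->
  exists2 D0, 0 < D0 & forall D, 0 <= D <= D0 ->
  exists v, [/\ Lambda_geo m v, `|u - v| = D
    & forall t, 0 <= t -> exists2 D',
        geo_flow m t v = shift2 D' (geo_flow m t u)
      & `|D'| <= D * expR (decay_rate * (T - t))].
Proof.
move=> [a [s [Sa as_ ->]]].
pose K := expR (- (lam2 m * lin_time a s)); have K0 : 0 < K by exact: expR_gt0.
exists (2^-1 * K) => [|D /andP[D0 DK]]; first by rewrite mulr_gt0// invr_gt0.
(* The move goes towards [u_2 = 0], where [section_S] always has room. *)
pose C := if 0 <= a.1.2 then - (D / K) else D / K.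
have C0 : 0 <= D / K by rewrite divr_ge0// ltW.
have nC : `|C| * K = D.
  rewrite /C (fun_if Num.norm) normrN if_same ger0_norm// divfK//.
  by rewrite gt_eqF.
have SCa : section_S (shift2 C a).
  have : D / K <= 2^-1 by rewrite ler_pdivrMr.
  case: Sa => a1; rewrite ler_norml => a2 a3 CK; split=> //=.
  by rewrite ler_norml /C; case: (leP 0 a.1.2) => *; lra.
have Cas : before_return m (shift2 C a) s by case: as_.
exists (loop_path m (shift2 C a) s); split; first by exists (shift2 C a), s.
  rewrite loop_path_shift//; case: (loop_path m a s) => -[x y] z.
  rewrite /shift2 /= !prod_normE /= !subrr normr0 opprD addNKr.
  rewrite (max_r (normr_ge0 _)) max_l// normrN normrM (@ger0_norm _ (expR _))//.
move=> t t0.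
have [p Ep] := path_from_exists Sa (addr_ge0 (proj1 as_) t0).
have [D' ED' bD'] := path_from_shift_midloop Sa SCa as_ t0 Ep.
exists D'; last by rewrite -/K nC in bD'.
by rewrite (geo_flowE Sa as_ t0 Ep) (geo_flowE SCa Cas t0 ED').
Qed.

End Model.
(** * The observations *)

Section Observations.
Context {R : realType}.

Lemma mx_entry_le_norm (n p : nat) (A : 'M[R]_(n, p)) i j : `|A i j| <= `|A|.
Proof.
rewrite /Num.norm/= mx_normrE.
exact: (le_bigmax _ (fun ij : 'I_n * 'I_p => `|A ij.1 ij.2|) (i, j)).
Qed.

(** What has to be checked is that the supremum in [opnorm] is over a bounded
    set. *)
Lemma opnorm_ge (d : nat) (H : 'M[R]_(d, 3)) (x : 'cV[R]_3) :
  `|x| <= 1 -> `|H *m x| <= opnorm H.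
Proof.
move=> x1; apply: ub_le_sup; last by exists x.
exists (\sum_(j < 3) `|H|) => _ [y /= y1 <-].
rewrite {1}/Num.norm/= mx_normrE; apply: bigmax_le => [|[i k] _ /=].
  by apply: sumr_ge0.
rewrite mxE; apply: le_trans (ler_norm_sum _ _ _) _; apply: ler_sum => j _.
rewrite normrM -[leRHS]mulr1 ler_pM ?mx_entry_le_norm//.
exact: le_trans (mx_entry_le_norm _ _ _) y1.
Qed.

Definition stable_dir : 'cV[R]_3 := colvec (0, 1, 0).

Lemma colvec_shift2 D (p : R3 R) :
  colvec (shift2 D p) = colvec p + D *: stable_dir.
Proof.
apply/matrixP => i j; rewrite !mxE /=.
by case: i => -[|[|[|]]] //= _; rewrite ?mulr0 ?addr0 ?mulr1.
Qed.

Lemma stable_dir_entry_le (d : nat) (H : 'M[R]_(d, 3)) j :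
  `|(H *m stable_dir) j 0| <= opnorm H.
Proof.
apply: le_trans (mx_entry_le_norm _ _ _) (opnorm_ge _ _).
rewrite /Num.norm/= mx_normrE; apply: bigmax_le => // -[i k] _ /=.
by rewrite mxE; case: i => -[|[|[|]]] //= _; rewrite ?normr0 ?normr1.
Qed.

Lemma noise_pdf_gt0 (d : nat) (eps : R) (z : 'cV[R]_d) : 0 < eps ->
  (forall j, `|z j 0| <= eps) -> 0 < noise_pdf eps z.
Proof.
move=> e0 ze; apply: prodr_gt0 => j _.
rewrite /uniform_pdf -ler_norml ze invr_gt0 opprK; lra.
Qed.

(** The residual of [p] at time [i * h] is the noise plus [H] applied to the
    difference of the two paths; the margin [opnorm H * b i] left by the noise
    absorbs the second term. *)
Lemma density_support_close (m : lorenz_param R) (d : nat) (H : 'M[R]_(d, 3))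
    q eps h k u p (z : nat -> d.-tuple R) (b : nat -> R) f :
    0 < eps -> Lambda_geo m p -> 0 < q p ->
    smoothing_density m H q eps h k (observation m H h u z) f ->
    (forall i : 'I_k.+1, exists2 D,
      geo_flow m (i%:R * h) p = shift2 D (geo_flow m (i%:R * h) u)
      & `|D| <= b i) ->
    (forall (i : 'I_k.+1) (j : 'I_d), `|tnth (z i) j| <= eps - opnorm H * b i) ->
  density_support m f p.
Proof.
move=> e0 Lp qp [C C0 fE] close small.
split => //; rewrite fE// gt_eqF// !mulr_gt0//.
apply: prodr_gt0 => i _; have [D -> bD] := close i.
apply: noise_pdf_gt0 => // j.
rewrite colvec_shift2 mulmxDr -scalemxAr /observation !mxE.
have -> x y t : x + y - (x + t) = y - t :> R by ring.
have := small i j; rewrite lerBrDr; apply: le_trans.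
apply: le_trans (ler_normB _ _) _; rewrite lerD2l normrM mulrC.
by rewrite ler_pM//; have := stable_dir_entry_le H j; rewrite mxE.
Qed.

Lemma diam_ge0 (A : set (R3 R)) : (0 <= diam A)%E.
Proof. by rewrite /diam le_max lexx. Qed.

Lemma diam_ge (A : set (R3 R)) u v : A u -> A v -> (`|u - v|%:E <= diam A)%E.
Proof.
move=> Au Av; rewrite /diam le_max; apply/orP; right.
by apply: ereal_sup_ubound; exists (u, v).
Qed.

(** The factor [1 / (g * h)], which is what makes the bound of the theorem
    proportional to [h], comes from [1 - expR (- x) >= x / (1 + x)]. *)
Lemma sum_decay_le (g t h : R) n : 0 < g -> 0 < h ->
  \sum_(i < n) expR (g * (t - i%:R * h)) <=
  expR (g * t) * ((1 + g * h) / (g * h)).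
Proof.
move=> g0 h0; have gh0 : 0 < g * h by rewrite mulr_gt0.
pose x := expR (- (g * h)); have x0 : 0 < x by exact: expR_gt0.
have x_le : x <= (1 + g * h)^-1.
  by rewrite /x expRN lef_pV2 ?posrE ?expR_gt0 ?expR_ge1Dx//; lra.
have x1 : x < 1 by rewrite /x expR_lt1 oppr_lt0.
have geom : \sum_(i < n) x ^+ i <= (1 - x)^-1.
  have := @geometric_le_lim R n 1 x ler01 x0; rewrite gtr0_norm// => /(_ x1).
  rewrite seriesEord /= mul1r; apply: le_trans.
  by apply: ler_sum => i _; rewrite mul1r.
have -> : \sum_(i < n) expR (g * (t - i%:R * h)) =
    expR (g * t) * \sum_(i < n) x ^+ i.
  rewrite mulr_sumr; apply: eq_bigr => i _.
  by rewrite /x -expRM_natl -expRD; congr expR; ring.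
rewrite ler_pM2l ?expR_gt0//; apply: le_trans geom _.
rewrite -[leRHS]invrK lef_pV2 ?posrE ?invr_gt0 ?divr_gt0//; [|lra..].
rewrite invf_div -subr_ge0; move: x_le; rewrite -subr_ge0.
suff -> : 1 - x - g * h / (1 + g * h) = (1 + g * h)^-1 - x by [].
by field; lra.
Qed.

Lemma ae_lebesgue3 (Q : R3 R -> Prop) :
  (forall u, Q u) -> {ae @lebesgue3 R, forall u, Q u}.
Proof.
move=> allQ; exists set0; split; [exact: measurable0|exact: measure0|].
by move=> u /(_ (allQ u)).
Qed.

End Observations.

(** * The noise *)

Section Probability.
Context {R : realType} (dT : measure_display) (T : measurableType dT)
  (P : probability T R).

Lemma measure_bigsetU_le (I : Type) (r : seq I) (Q : pred I) (B : I -> set T) :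
    (forall i, measurable (B i)) ->
  measurable (\big[setU/set0]_(i <- r | Q i) B i) /\
  (P (\big[setU/set0]_(i <- r | Q i) B i) <= \sum_(i <- r | Q i) P (B i))%E.
Proof.
move=> mB; apply: (big_ind2 (fun A x => measurable A /\ (P A <= x)%E)) => //.
  by rewrite measure0.
move=> A1 x1 A2 x2 [mA1 A1x] [mA2 A2x]; split; first exact: measurableU.
by apply: le_trans (leeD A1x A2x); exact: measureU2.
Qed.

(** The diameter of a random support need not be measurable, so monotonicity of
    the integral is needed without measurability; it holds because the integral
    of a nonnegative function is a supremum over the simple functions below. *)
Lemma integral_le_nonmeasurable (f g : T -> \bar R) :
  (forall w, 0 <= f w)%E -> (forall w, f w <= g w)%E ->
  (\int[P]_w f w <= \int[P]_w g w)%E.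
Proof.
move=> f0 fg; rewrite !ge0_integralTE//; last first.
  by move=> w; apply: le_trans (fg w).
apply: le_ereal_sup => _ [h hf <-]; exists h => // w.
exact: le_trans (hf w) (fg w).
Qed.

Lemma expectation_ge_half (bad : set T) (g : T -> \bar R) (c : R) : 0 <= c ->
    measurable bad -> (P bad <= 2^-1%:E)%E -> (forall w, 0 <= g w)%E ->
    {ae P, forall w, ~ bad w -> (c%:E <= g w)%E} ->
  ((c / 2)%:E <= \int[P]_w g w)%E.
Proof.
move=> c0 mb bh g0 [N [mN PN0 sN]].
have mG : measurable (~` (bad `|` N)) by apply/measurableC/measurableU.
apply: (@le_trans _ _ (\int[P]_w (c%:E * (\1_(~` (bad `|` N)) w)%:E))%E);
    last first.
  apply: integral_le_nonmeasurable => w.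
    by rewrite mule_ge0 ?lee_fin.
  rewrite indicE; case: (boolP (w \in _)) => [|_]; last by rewrite mule0.
  rewrite inE mule1 => /= nbN; apply: contrapT => cg; apply: nbN.
  have [?|nb] := pselect (bad w); [by left|right].
  by apply: sN => /= /(_ nb).
rewrite ge0_integralZl//; last first.
  by apply/measurable_EFinP; exact: measurable_indic.
rewrite integral_indic// setIT.
have /= -> := probability_setC P (measurableU _ _ mb mN).
rewrite EFinM lee_wpmul2l ?lee_fin//.
have -> : 2^-1%:E = (1 - 2^-1%:E)%E :> \bar R by rewrite -EFinD; congr EFin; lra.
rewrite leeB//; apply: le_trans bh; apply: le_trans (measureU2 _ _ _) _ => //.
by rewrite [X in (_ + X)%E]PN0 adde0.
Qed.

(** The other coordinates contribute total mass 1 to the product of integrals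
    that defines the law of [X]. *)
Lemma cube_coord_tail (d : nat) (eps a : R) (X : {RV P >-> d.-tuple R}) j :
  0 < eps -> 0 <= a -> uniform_on_cube eps X ->
  measurable [set w | (eps - a < `|tnth (X w) j|)%R] /\
  (P [set w | (eps - a < `|tnth (X w) j|)%R] <= (a / eps)%:E)%E.
Proof.
move=> e0 a0 uX.
have tailC : [set x : R | eps - a < `|x|] = ~` `[- (eps - a), eps - a]%classic.
  by apply/seteqP; split => x /=; rewrite in_itv /= -ler_norml ltNge => /negP.
have mA : measurable [set x : R | eps - a < `|x|].
  by rewrite tailC; exact: measurableC.
have mE : measurable [set w | (eps - a < `|tnth (X w) j|)%R].
  have mX : measurable_fun setT (fun w => tnth (X w) j).
    apply: measurableT_comp (@measurable_tnth _ R d j) _.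
    exact: (@measurable_funPT _ _ _ _ X).
  by have := mX measurableT _ mA; rewrite setTI.
split => //.
have [ae|ea] := leP eps a.
  apply: le_trans (probability_le1 _ _) _ => //.
  by rewrite lee_fin ler_pdivlMr// mul1r.
pose A l := if l == j then [set x : R | eps - a < `|x|] else setT.
have := uX A.
rewrite (_ : [set w | _] = [set w | (eps - a < `|tnth (X w) j|)%R]); last first.
  apply/seteqP; split => w /=; first by move=> /(_ j); rewrite /A eqxx.
  by move=> wj l; rewrite /A; case: eqP => // ->.
move=> -> //; last by move=> l; rewrite /A; case: ifP.
have ee : - eps < eps by lra.
rewrite (bigD1 j)//= {1}/A eqxx big1 ?mule1; last first.
  by move=> l /negbTE lj; rewrite /A lj integral_uniform_pdf1.
rewrite -/(uniform_prob ee _) tailC probability_setC//.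
rewrite /= /uniform_prob (eq_integral (fun=> (eps - - eps)^-1%:E)); last first.
  move=> x; rewrite inE /= in_itv /= => /andP[x1 x2].
  by rewrite /uniform_pdf ifT//; lra.
rewrite integral_cst//= lebesgue_measure_itv/= lte_fin ifT; last by lra.
rewrite -(EFinD (eps - a)) -EFinM -(EFinB 1) lee_fin le_eqVlt.
by apply/orP; left; apply/eqP; field; lra.
Qed.

Lemma union_tail (d : nat) (eps : R) (Z : nat -> {RV P >-> d.-tuple R})
    (a : nat -> R) n : 0 < eps -> (forall i, 0 <= a i) ->
    (forall i, uniform_on_cube eps (Z i)) ->
  exists bad : set T, [/\ measurable bad,
    (P bad <= (d%:R * (\sum_(i < n) a i) / eps)%:E)%E
    & forall w, ~ bad w ->
        forall (i : 'I_n) (j : 'I_d), `|tnth (Z i w) j| <= eps - a i].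
Proof.
move=> e0 a0 uZ.
pose B (ij : 'I_n * 'I_d) : set T :=
  [set w | eps - a ij.1 < `|tnth (Z ij.1 w) ij.2|].
have tB (ij : 'I_n * 'I_d) := cube_coord_tail ij.2 e0 (a0 ij.1) (uZ ij.1).
have [mU PU] := measure_bigsetU_le (index_enum _) predT
  (fun ij => (tB ij).1 : measurable (B ij)).
exists (\big[setU/set0]_ij B ij); split => //.
  apply: le_trans PU _; apply: le_trans (lee_sum _ (fun ij _ => (tB ij).2)) _.
  rewrite sumEFin lee_fin le_eqVlt; apply/orP; left; apply/eqP.
  rewrite -(pair_big predT predT (fun (i : 'I_n) (j : 'I_d) => a i / eps))/=.
  under eq_bigr do rewrite sumr_const card_ord -mulr_natl.
  by rewrite -mulr_sumr -mulr_suml mulrA.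
move=> w nb i j; rewrite leNgt; apply/negP => tl; apply: nb.
by rewrite -bigcup_seq; exists (i, j) => //=; rewrite mem_index_enum.
Qed.

End Probability.

(** * The expected diameter *)

Theorem theorem2p2 (R : realType) (m : lorenz_param R) (d : nat) (hmax : R) :
  admissible m -> 0 < hmax ->
  exists2 c_sm : R, 0 < c_sm &
  forall (H : 'M[R]_(d, 3)) (q : R3 R -> R),
  prob_density_on (Lambda_geo m) q ->
  (forall v, Lambda_geo m v -> 0 < q v) ->
  {ae @lebesgue3 R, forall u : R3 R, Lambda_geo m u ->
    exists2 rho : R, 0 < rho &
    forall eps h : R, 0 < eps -> 0 < h -> h <= hmax -> eps * h < rho ->
    forall (dT : measure_display) (T : measurableType dT)
      (P : probability T R) (Z : nat -> {RV P >-> d.-tuple R}),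
    mutually_independent Z ->
    (forall i, uniform_on_cube eps (Z i)) ->
    forall (k : nat) (f : T -> R3 R -> R),
    {ae P, forall w, smoothing_density m H q eps h k
                       (observation m H h u (fun i => Z i w)) (f w)} ->
    ((c_sm * h * eps / opnorm H)%:E <=
       \int[P]_w diam (density_support m (f w)))%E }.
Proof.
move=> adm hmax0.
set g := decay_rate m; have g0 : 0 < g by exact: decay_rate_gt0.
(* The sum of the distances between the two paths at the observation times is
   at most [K / h] times the initial distance, and [c] makes the union bound
   over the [d] coordinates at most one half; [d.+1] covers [d = 0]. *)
pose K := expR (g * rot_time) * (1 + g * hmax) / g.
have K0 : 0 < K.
  by rewrite divr_gt0// mulr_gt0 ?expR_gt0// addr_gt0// mulr_gt0.
pose c := (2 * d.+1%:R * K)^-1.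
have c0 : 0 < c by rewrite invr_gt0 mulr_gt0// mulr_gt0.
exists (c / 2); first by rewrite divr_gt0.
move=> H q _ q0; apply: ae_lebesgue3 => u Lu.
have [N0|N0] := leP (opnorm H) 0.
  exists 1 => // eps h e0 h0 _ _ dT T P Z _ _ k f _.
  apply: (@le_trans _ _ 0%E); last by apply: integral_ge0 => w _; exact: diam_ge0.
  by rewrite lee_fin mulr_ge0_le0 ?invr_le0// !mulr_ge0// ltW// divr_gt0.
have [D0 D00 neighbour] := stable_neighbour adm Lu.
(* Chosen so that the distance [D] below is at most [D0]. *)
exists (D0 * opnorm H / c); first by rewrite divr_gt0// mulr_gt0.
move=> eps h e0 h0 hh eh dT T P Z _ uZ k f fP.
pose D := c * h * eps / opnorm H.
have Dpos : 0 < D by rewrite divr_gt0// !mulr_gt0.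
have [|v [Lv uv flowv]] := neighbour D.
  rewrite ltW//= /D ler_pdivrMr// -mulrA mulrC -ler_pdivlMr// mulrC.
  exact: ltW.
pose b (i : nat) := D * expR (g * (rot_time - i%:R * h)).
have b0 i : 0 <= b i by apply: mulr_ge0; [exact: ltW|exact: expR_ge0].
have sum_b : \sum_(i < k.+1) opnorm H * b i <= c * eps * K.
  rewrite -mulr_sumr -mulr_sumr mulrA.
  apply: le_trans (ler_wpM2l _ (sum_decay_le rot_time k.+1 g0 h0)) _.
    by rewrite mulr_ge0// ltW.
  have -> : opnorm H * D * (expR (g * rot_time) * ((1 + g * h) / (g * h))) =
      c * eps * (expR (g * rot_time) * (1 + g * h) / g).
    by rewrite /D; field; rewrite !gt_eqF.
  rewrite ler_pM2l; last exact: mulr_gt0.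
  by rewrite ler_pM2r ?invr_gt0// ler_pM2l ?expR_gt0// lerD2l ler_pM2l.
have half : d%:R * (\sum_(i < k.+1) opnorm H * b i) / eps <= 2^-1.
  rewrite ler_pdivrMr//; apply: le_trans (ler_wpM2l (ler0n _ _) sum_b) _.
  have -> : d%:R * (c * eps * K) = 2^-1 * eps * (d%:R / d.+1%:R).
    move: (pnatr_eq0 R d.+1) (lt0r_neq0 K0); rewrite /c.
    by move: (d.+1%:R) (K) => x y /negbT x0 y0; field; rewrite x0.
  rewrite ler_piMr ?mulr_ge0 ?invr_ge0 ?(ltW e0)//.
  by rewrite ler_pdivrMr// mul1r ler_nat.
have Hb0 i : 0 <= opnorm H * b i by rewrite mulr_ge0// ltW.
have [bad [mbad Pbad good]] := union_tail k.+1 e0 Hb0 uZ.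
have -> : c / 2 * h * eps / opnorm H = D / 2 by rewrite /D; field; lra.
apply: (expectation_ge_half (ltW Dpos) mbad).
- by apply: le_trans Pbad _; rewrite lee_fin.
- by move=> w; exact: diam_ge0.
apply: filterS fP => w fw nbad; rewrite -uv.
apply: diam_ge; apply: (density_support_close e0 _ _ fw _ (good w nbad)) => //;
  try exact: q0.
- move=> i; exists 0; last by rewrite normr0.
  by rewrite /shift2 addr0 -!surjective_pairing.
- by move=> i; exact: flowv (mulr_ge0 (ler0n _ _) (ltW h0)).
Qed.
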